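(* Let $S = \langle a_1, \ldots, a_k\rangle$ be a numerical semigroup with minimal generators $a_1 < \cdots < a_k$, $k \ge 2$. Let $A = a_1 + \cdots + a_k$, $g_1 = \gcd(a_2, \ldots, a_k)$, and $p = \operatorname{lcm}(a_1, g_1a_2, A)$. Then for all sufficiently large $x \in S$, we have $\Delta_\infty(x + p) = \Delta_\infty(x)$.
   Context: A numerical semigroup is a cofinite, additively closed subset $S \subseteq \mathbb{Z}_{\ge 0}$ containing $0$. For $x \in S$, $\mathsf Z(x) = \{z \in \mathbb{Z}_{\ge 0}^k : x = z_1a_1 + \cdots + z_ka_k\}$; for $z \in \mathsf Z(x)$, $\ell_\infty(z) = \max(z_1,\ldots,z_k)$; $\mathcal L_\infty(x) = \{\ell_\infty(z) : z \in \mathsf Z(x)\}$. Writing $\mathcal L_\infty(x) = \{c_1 < \cdots < c_r\}$, the $\infty$-delta set of $x$ is $\Delta_\infty(x) = \{c_j - c_{j-1} : j = 2, \ldots, r\}$. *)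

(* Defs.v *)
From mathcomp Require Import all_boot.
From mathcomp Require Import boolp classical_sets cardinality.

Set Implicit Arguments.
Unset Strict Implicit.
Unset Printing Implicit Defensive.

Local Open Scope classical_set_scope.
Local Open Scope nat_scope.

Definition numerical_semigroup (S : set nat) : Prop :=
  [/\ S 0, (forall x y, S x -> S y -> S (x + y)) & finite_set (~` S)].

Section Generators.
Variables (k : nat) (a : 'I_k -> nat).

Definition generated (J : {set 'I_k}) : set nat :=
  [set x | exists z : {ffun 'I_k -> nat}, x = \sum_(i in J) z i * a i].

Definition minimal_generators (S : set nat) : Prop :=
  generated [set: 'I_k]%SET = S /\
  forall J : {set 'I_k}, J \proper [set: 'I_k]%SET -> generated J <> S.

Definition factorizations (x : nat) : set {ffun 'I_k -> nat} :=
  [set z | x = \sum_(i < k) z i * a i].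

Definition infty_length (z : {ffun 'I_k -> nat}) : nat := \max_(i < k) z i.

Definition infty_length_set (x : nat) : set nat :=
  infty_length @` factorizations x.

(* The increasing enumeration c exists (and is then unique) exactly when the
   length set is finite, as is the case when all the generators are positive. *)
Definition infty_delta_set (x : nat) : set nat :=
  [set d | exists c : seq nat,
     [/\ sorted ltn c, [set` c] = infty_length_set x &
         exists2 j, 0 < j < size c & d = nth 0 c j - nth 0 c j.-1]].

End Generators.

(* Main.v *)
Require Import Defs.
From mathcomp Require Import all_boot zify.
From mathcomp Require Import boolp classical_sets cardinality.

Local Open Scope nat_scope.

(** Write L(x) for the set of infinity-lengths of x, A for the sum of the
    generators, and, for each i, S_i for the semigroup generated by the a_j with
    j <> i and g_i for the gcd of these a_j.

    A factorization z of x has maximum l, attained at i, exactly when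
    x - l * a_i is a combination of the other generators with coefficients at
    most l.  Complementing the coefficients (z_j becomes l - z_j) shows that
    both x - l * a_i and l * A - x then lie in S_i, and for large l the converse
    holds as well ([bounded_factorization]).  So, for large x, the set L(x) is
    the union over i of { l | x - l * a_i in S_i and l * A - x in S_i }
    ([infty_length_setE]).  Since S_i contains every large multiple of g_i, each
    of these sets is the residue class l * a_i = x mod g_i on the interval
    [x / A, x / a_i], except within a bounded distance of the two endpoints.

    Let i1 and i2 be the indices of the two smallest generators.  The endpoints
    x / A, x / a_i2 and x / a_i1 cut L(x) into regimes:
    - near x / A, membership of l depends only on l * A - x, so the picture is
      translated when x moves by a multiple of A;
    - between x / A and x / a_i2, the classes of i1 and i2 are both full, so the
      gaps are at most min(g_i1, g_i2); since g_i1 and g_i2 are coprime, the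
      Chinese remainder theorem realizes all the values 1, ..., min(g_i1, g_i2)
      just below x / a_i2, where the other generators no longer contribute.  The
      endpoints x / a_j of the other generators all lie in this regime and hence
      do not influence the set of gaps;
    - near x / a_i2, membership depends on x - l * a_i2 and on l * a_i1 - x
      mod g_i1, so the picture is translated when x moves by a multiple of
      g_i1 * a_i2;
    - between x / a_i2 and x / a_i1, the only gap is g_i1;
    - near x / a_i1, membership depends only on x - l * a_i1, so the picture is
      translated when x moves by a multiple of a_i1.
    Gaps are uniformly bounded ([gap_bounded]), so every gap lies inside one of
    these regimes, provided the windows around the three endpoints are taken
    large enough.  Hence x and y have the same gaps as soon as both are large
    and congruent modulo A, a_i1 and g_i1 * a_i2 ([gap_transfer]). *)

(** * Gaps of a set of natural numbers *)

Definition gap_at (L : set nat) (u d : nat) : Prop :=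
  [/\ L u, L (u + d), 0 < d & forall e, 0 < e < d -> ~ L (u + e)].

Definition gap (L : set nat) (d : nat) : Prop := exists u, gap_at L u d.

Lemma gap_shift (L L' : set nat) (u u' d : nat) :
  (forall e, e <= d -> L (u + e) <-> L' (u' + e)) ->
  gap_at L u d -> gap L' d.
Proof.
move=> LL' [Lu Lud d0 Lno]; exists u'; split=> //.
- by rewrite -(addn0 u'); apply/LL'=> //; rewrite addn0.
- by apply/LL'.
- move=> e /andP[e0 ed] L'e; apply: (Lno e); first by rewrite e0.
  by apply/LL' => //; exact: ltnW.
Qed.

(** This turns the steps of an increasing enumeration into a property of the set
    alone, which can be transported along translations. *)
Lemma sorted_steps_gap (c : seq nat) (d : nat) : sorted ltn c ->
  (exists2 j, 0 < j < size c & d = nth 0 c j - nth 0 c j.-1) <->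
  gap [set` c] d.
Proof.
move=> sc.
have mono i j : i < size c -> j < size c -> (nth 0 c i < nth 0 c j) = (i < j).
  move=> ic jc; apply/idP/idP; last first.
    by move=> ij; apply: (sorted_ltn_nth ltn_trans 0 sc).
  apply: contraTT; rewrite -!leqNgt leq_eqVlt => /orP[/eqP-> //|ji].
  by apply: ltnW; apply: (sorted_ltn_nth ltn_trans 0 sc).
split.
- move=> [j /andP[j0 jc] ->]; have jc' : j.-1 < size c by lia.
  have step : nth 0 c j.-1 < nth 0 c j by rewrite mono //; lia.
  exists (nth 0 c j.-1); rewrite /gap_at /= subnKC ?(ltnW step) // subn_gt0.
  rewrite !mem_nth //; split=> // e /andP[e0 ed] /(nthP 0) [i ic ei].
  have : j.-1 < i by rewrite -mono // ei; lia.
  have : i < j by rewrite -mono // ei; lia.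
  lia.
- move=> [u [/= /(nthP 0) [i ic ei] /(nthP 0) [j jc ej] d0 noe]].
  have ij : i < j by rewrite -mono // ei ej -[X in X < _]addn0 ltn_add2l.
  suff ji : j = i.+1 by exists j; [rewrite jc ji | rewrite [in j.-1]ji ei ej addKn].
  apply/eqP; rewrite eqn_leq ij andbT leqNgt; apply/negP => ij1.
  have ic1 : i.+1 < size c := ltn_trans ij1 jc.
  have lo : nth 0 c i < nth 0 c i.+1 by rewrite mono.
  rewrite ei in lo.
  have hi : nth 0 c i.+1 < nth 0 c j by rewrite mono.
  rewrite ej in hi.
  apply: (noe (nth 0 c i.+1 - u)); first by lia.
  by rewrite /= subnKC; [exact: mem_nth | lia].
Qed.

Lemma infty_delta_setE {k : nat} (a : 'I_k -> nat) (x M : nat) :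
  (forall l, infty_length_set a x l -> l <= M) ->
  infty_delta_set a x = gap (infty_length_set a x).
Proof.
move=> bnd; apply/predeqP => d; split.
  by move=> [c [sc <-]]; move/(sorted_steps_gap c d sc).
move=> Ld.
have [c [sc Lc]] : exists c, sorted ltn c /\ [set` c]%classic = infty_length_set a x.
  exists [seq l <- iota 0 M.+1 | `[< infty_length_set a x l >]]; split.
    by apply: sorted_filter; [exact: ltn_trans | exact: iota_ltn_sorted].
  apply/predeqP => l; rewrite /mkset mem_filter mem_iota; split.
    by case/andP => /asboolP.
  by move=> Ll; apply/andP; split; [exact/asboolP | have := bnd _ Ll; lia].
by exists c; split=> //; apply/(sorted_steps_gap c d sc); rewrite Lc.
Qed.

(** * Semigroups generated by a subfamily *)

Definition gcd_over {k : nat} (a : 'I_k -> nat) (J : {set 'I_k}) : nat :=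
  \big[gcdn/0]_(j in J) a j.

Lemma gcd_over_dvd_generated {k : nat} (a : 'I_k -> nat) (J : {set 'I_k}) n :
  generated a J n -> gcd_over a J %| n.
Proof.
move=> [z ->]; apply: dvdn_sum => j jJ; apply: dvdn_mull.
exact: (dvdn_biggcdP _ _ _ (dvdnn _)).
Qed.

Lemma linear_congruence_sol (a g n : nat) : 0 < g -> gcdn a g %| n ->
  exists2 t, t < g & t * a = n %[mod g].
Proof.
move=> g0 /dvdnP[c ->].
case: (posnP a) => [->|a0].
  by exists 0 => //; rewrite mul0n gcd0n modnMl mod0n.
case: (egcdnP g a0) => ka kg e _.
exists ((c * ka) %% g); first exact: ltn_pmod.
by rewrite modnMml -mulnA e mulnDr mulnA modnMDl.
Qed.

(** Induction on J: removing a generator a_i, a suitable multiple t * a_i with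
    t < gcd (J minus i) corrects the residue of n, and the rest of n is handled
    by the induction hypothesis. *)
Lemma generated_frobenius {k : nat} (a : 'I_k -> nat) (J : {set 'I_k}) :
  exists C, forall n, C <= n -> gcd_over a J %| n -> generated a J n.
Proof.
have [m] := ubnP #|J|; elim: m J => // m IH J Jm.
have [->|[i iJ]] := set_0Vmem J.
  exists 0 => n _; rewrite /gcd_over big_set0 dvd0n => /eqP ->.
  by exists [ffun => 0]; rewrite big_set0.
have {}Jm : #|J :\ i| < m by have := cardsD1 i J; rewrite iJ; lia.
have [C HC] := IH _ Jm.
have gE : gcd_over a J = gcdn (a i) (gcd_over a (J :\ i)).
  by rewrite /gcd_over (big_setD1 i iJ).
have ext t n : generated a (J :\ i) n -> generated a J (t * a i + n).
  move=> [z ->]; exists [ffun j => if j == i then t else z j].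
  rewrite (big_setD1 i iJ) /= ffunE eqxx; congr (_ + _).
  by apply: eq_bigr => j; rewrite !inE => /andP[/negPf ji _]; rewrite ffunE ji.
set g := gcd_over a (J :\ i) in gE HC.
case: (posnP g) => [g0|g0].
  exists 0 => n _; rewrite gE g0 gcdn0 => /dvdnP[t ->].
  rewrite -[t * _]addn0; apply: ext; exists [ffun => 0].
  by rewrite big1 // => j _; rewrite ffunE.
exists (C + g * a i) => n Cn; rewrite gE => gn.
have [t tg tn] := linear_congruence_sol _ _ _ g0 gn.
have tan : t * a i <= n by nia.
rewrite -(subnKC tan); apply/ext/HC; first by nia.
by rewrite -eqn_mod_dvd //; apply/eqP.
Qed.

(** With B the sum of the a_j over J, complementing the coefficients exchanges n
    and l * B - n, so one may assume that n is at most half of l * B.  Then n is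
    t * B plus a bounded remainder in the semigroup with t <= l / 2: all the
    coefficients are t plus a bounded amount, hence at most l. *)
Lemma bounded_factorization {k : nat} (a : 'I_k -> nat) (J : {set 'I_k}) :
  (forall j, 0 < a j) ->
  exists l0, forall l n, l0 <= l -> generated a J n ->
    (generated a J (l * (\sum_(j in J) a j) - n)) ->
    n <= l * (\sum_(j in J) a j) ->
    exists z : {ffun 'I_k -> nat},
     n = \sum_(j in J) z j * a j /\ forall j, j \in J -> z j <= l.
Proof.
move=> a0; have [C HC] := generated_frobenius a J.
set B := \sum_(j in J) a j.
have coord z n j : n = \sum_(j in J) z j * a j -> j \in J -> z j <= n.
  move=> -> jJ; rewrite (bigD1 j jJ) /=; have := a0 j; nia.
have half l n : (C + B).*2 <= l -> generated a J n -> n.*2 <= l * B ->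
    exists z : {ffun 'I_k -> nat},
     n = \sum_(j in J) z j * a j /\ forall j, j \in J -> z j <= l.
  move=> Ll nJ nl; case: (ltnP n C) => nC.
    case: nJ => z zE; exists z; split=> // j jJ.
    have := coord _ _ _ zE jJ; lia.
  case: (posnP B) => [B0|B0].
    case: nJ => z zE; exists z; split=> // j jJ.
    have := coord _ _ _ zE jJ; rewrite B0 in nl; lia.
  set t := (n - C) %/ B; have tE := divn_eq (n - C) B; rewrite -/t in tE.
  have := ltn_pmod (n - C) B0; set r := _ %% B in tE * => rB.
  have [w wE] : generated a J (C + r).
    apply: HC; first exact: leq_addr.
    have -> : C + r = n - t * B by lia.
    apply: dvdn_sub; first exact: gcd_over_dvd_generated.
    apply: dvdn_mull; apply: gcd_over_dvd_generated.
    by exists [ffun => 1]; apply: eq_bigr => j _; rewrite ffunE mul1n.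
  exists [ffun j => t + w j]; split=> [|j jJ].
    have -> : n = t * B + (C + r) by lia.
    rewrite wE /B big_distrr -big_split /=.
    by apply: eq_bigr => j _; rewrite ffunE mulnDl.
  rewrite ffunE; have := coord _ _ _ wE jJ => wj.
  have : t.*2 <= l by rewrite -(leq_pmul2r B0); lia.
  lia.
exists (C + B).*2 => l n Ll nJ nJ' nl.
case: (leqP n.*2 (l * B)) => n2; first exact: half.
have n2' : (l * B - n).*2 <= l * B by lia.
have [z [zE zl]] := half _ _ Ll nJ' n2'.
exists [ffun j => l - z j]; split=> [|j jJ]; last by rewrite ffunE leq_subr.
have -> : n = l * B - (l * B - n) by lia.
rewrite zE /B big_distrr -sumnB /= => [|j jJ]; last by rewrite leq_mul2r zl ?orbT.
by apply: eq_bigr => j _; rewrite ffunE mulnBl.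
Qed.

(** * The set of infinity-lengths of a large element *)

Lemma sum_others {k : nat} (F : 'I_k -> nat) (i : 'I_k) :
  \sum_(j < k) F j = F i + \sum_(j in [set~ i]) F j.
Proof.
by rewrite (bigD1 i) //=; congr (_ + _); apply: eq_bigl => j; rewrite in_setC1.
Qed.

Lemma gcd_over_setT {k : nat} (a : 'I_k -> nat) (i : 'I_k) :
  gcd_over a [set: 'I_k] = gcdn (a i) (gcd_over a [set~ i]).
Proof. by rewrite /gcd_over (big_setD1 i) ?inE // finset.setTD. Qed.

Lemma gcd_over_dvd {k : nat} (a : 'I_k -> nat) (J : {set 'I_k}) (j : 'I_k) :
  j \in J -> gcd_over a J %| a j.
Proof. by move=> jJ; apply: (dvdn_biggcdP _ _ _ (dvdnn _)). Qed.

(** An index i where the maximum is attained is the witness; x is large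
    so that l is large enough for [bounded_factorization]. *)
Lemma infty_length_setE {k : nat} (a : 'I_k -> nat) : (forall j, 0 < a j) ->
  exists N, forall x l, N <= x ->
    infty_length_set a x l <->
    exists i, [/\ l * a i <= x, x <= l * \sum_(j < k) a j,
      generated a [set~ i] (x - l * a i) &
      generated a [set~ i] (l * (\sum_(j < k) a j) - x)].
Proof.
move=> a0.
have [f Hf] := choice (fun i => bounded_factorization a [set~ i] a0).
pose l0 := (\max_i f i).+1.
exists (l0 * (\sum_(j < k) a j).+1) => x l Nx; split.
- move=> [z /= xE lE].
  have zl j : z j <= l by rewrite -lE; exact: leq_bigmax.
  have k0 : 0 < #|'I_k|.
    rewrite card_ord lt0n; apply/eqP => k0; subst k; move: Nx.
    by rewrite xE !big_ord0 muln1; rewrite /l0.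
  have [i zi] := eq_bigmax z k0.
  have {}zi : z i = l by rewrite -lE /infty_length zi.
  have xi : x = l * a i + \sum_(j in [set~ i]) z j * a j.
    by rewrite xE (sum_others _ i) zi.
  have xA : x <= l * \sum_(j < k) a j.
    by rewrite xE big_distrr /=; apply: leq_sum => j _; rewrite leq_mul2r zl orbT.
  exists i; split=> //.
  + by rewrite xi leq_addr.
  + by exists z; rewrite xi addKn.
  + exists [ffun j => l - z j]; rewrite (sum_others _ i) mulnDr {1}xi subnDl.
    rewrite big_distrr -sumnB /= => [|j _]; last by rewrite leq_mul2r zl orbT.
    by apply: eq_bigr => j _; rewrite ffunE mulnBl.
- move=> [i [lx xA Si Si']].
  have ll0 : f i <= l.
    have : f i < l0 by exact: leq_bigmax.
    nia.
  rewrite (sum_others _ i) mulnDr in xA Si'.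
  have e : l * a i + l * (\sum_(j in [set~ i]) a j) - x =
         l * (\sum_(j in [set~ i]) a j) - (x - l * a i) by lia.
  rewrite e in Si'; have nl : x - l * a i <= l * (\sum_(j in [set~ i]) a j) by lia.
  have [z [zE zl]] := Hf i l _ ll0 Si Si' nl.
  exists [ffun j => if j == i then l else z j].
    rewrite /factorizations /mkset (sum_others _ i) ffunE eqxx.
    rewrite -[LHS](subnKC lx) zE; congr (_ + _); apply: eq_bigr => j.
    by rewrite in_setC1 ffunE => /negPf ->.
  rewrite /infty_length; apply/eqP; rewrite eqn_leq; apply/andP; split.
    apply/bigmax_leqP => j _; rewrite ffunE; case: eqP => // /eqP ji.
    by apply: zl; rewrite in_setC1.
  by have := leq_bigmax (F := [ffun j => if j == i then l else z j]) i; rewrite ffunE eqxx.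
Qed.

Lemma generated_frobenius_uniform {k : nat} (a : 'I_k -> nat) :
  exists C, forall i n, C <= n -> gcd_over a [set~ i] %| n -> generated a [set~ i] n.
Proof.
have [f Hf] := choice (fun i => generated_frobenius a [set~ i]).
exists (\max_i f i) => i n Cn; apply: Hf.
by apply: leq_trans Cn; exact: leq_bigmax.
Qed.

(** * Residue classes and windows *)

Lemma residue_window (m r T : nat) : 0 < m ->
  exists t, [/\ T <= t, t < T + m & t = r %[mod m]].
Proof.
move=> m0; exists (T + (r + T * m.-1) %% m).
rewrite leq_addr ltn_add2l ltn_pmod //; split=> //.
rewrite modnDmr addnCA -{1}[T]muln1 -mulnDr add1n prednK //.
by rewrite addnC modnMDl.
Qed.

Lemma class_window (b g x T : nat) : 0 < g -> coprime b g ->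
  exists t, [/\ T <= t, t < T + g & t * b = x %[mod g]].
Proof.
move=> g0 cop; have [s _ sE] : exists2 t, t < g & t * b = x %[mod g].
  by apply: linear_congruence_sol => //; rewrite (eqP cop) dvd1n.
have [t [Tt tT tE]] := residue_window g s T g0.
by exists t; split=> //; rewrite -modnMml tE modnMml.
Qed.

Lemma class_eq (b g x s t : nat) : coprime b g ->
  s * b = x %[mod g] -> t * b = x %[mod g] -> s = t %[mod g].
Proof.
move=> cop sx tx; apply/eqP.
wlog st : s t sx tx / t <= s.
  move=> W; case: (leqP t s) => [|/ltnW] st; first exact: W.
  by rewrite eq_sym; apply: W.
have : s * b == t * b %[mod g] by rewrite sx tx.
rewrite !eqn_mod_dvd ?leq_mul2r ?st ?orbT // -mulnBl Gauss_dvdl //.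
by rewrite coprime_sym.
Qed.

(** Writing the translation u' = u + (y - x) / b without subtraction lets it go
    in either direction. *)
Lemma shift_exists (b x y u : nat) : 0 < b -> x = y %[mod b] -> x <= u * b + y ->
  exists u', u' * b + x = u * b + y.
Proof.
move=> b0 xy le; exists ((u * b + y - x) %/ b).
rewrite divnK ?subnK //.
by rewrite -eqn_mod_dvd // modnMDl xy.
Qed.

(** The interval [y / be, y / al] has length proportional to y, so it eventually
    contains any window of fixed width W, with margins. *)
Lemma linear_window (al be C W : nat) : al < be ->
  exists N, forall y, N <= y -> exists T, y + C <= T * be /\ (T + W) * al + C <= y.
Proof.
move=> ab; exists ((C + be + W * be) * al + be * C) => y Ny.
exists ((y + C) %/ be).+1; split; first by apply: ltnW; rewrite ltn_ceil; lia.
set T := _ %/ be; have TE : T * be <= y + C by exact: leq_trunc_div.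
have b0 : 0 < be by lia.
rewrite -(leq_pmul2r b0).
have : T * be * al <= (y + C) * al by rewrite leq_mul2r TE orbT.
have : y * al.+1 <= y * be by rewrite leq_mul2l ab orbT.
nia.
Qed.

(** The gcd of the other generators divides their sum, so l * A - x and
    l * a_i - x have the same residue. *)
Lemma gcd_over_mod {k : nat} (a : 'I_k -> nat) (i : 'I_k) (l x : nat) :
  (l * (\sum_(j < k) a j) == x %[mod gcd_over a [set~ i]]) =
  (l * a i == x %[mod gcd_over a [set~ i]]).
Proof.
have /dvdnP[c cE] : gcd_over a [set~ i] %| \sum_(j in [set~ i]) a j.
  by apply: dvdn_sum => j /(gcd_over_dvd a).
by rewrite (sum_others _ i) cE mulnDr mulnA addnC modnMDl.
Qed.

(** * Shape of the length set in each regime *)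

Section Regimes.

Variables (k : nat) (a : 'I_k -> nat) (i1 i2 : 'I_k).
Hypothesis a_gt0 : forall j, 0 < a j.
Hypothesis gcd1 : gcd_over a [set: 'I_k] = 1.
Hypothesis a12 : a i1 < a i2.
Hypothesis a2_min : forall j, j != i1 -> j != i2 -> a i2 < a j.

Let A := \sum_(j < k) a j.
Let g i := gcd_over a [set~ i].
Let L := infty_length_set a.

Lemma i1_neq_i2 : i1 != i2.
Proof. by apply/eqP => e; move: a12; rewrite e ltnn. Qed.

Lemma a1_min j : a i1 <= a j.
Proof.
case: (eqVneq j i1) => [-> //|j1]; case: (eqVneq j i2) => [->|j2].
  exact: ltnW.
by apply: ltnW; apply: ltn_trans a12 (a2_min _ j1 j2).
Qed.

Lemma coprime_gcd_others i : coprime (a i) (g i).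
Proof. by rewrite /coprime -gcd_over_setT gcd1. Qed.

(** Each generator is divisible by g_i or by g_j, so a common divisor of g_i and
    g_j divides all of them. *)
Lemma coprime_gcds i j : i != j -> coprime (g i) (g j).
Proof.
move=> ij; rewrite /coprime -dvdn1 -gcd1; apply/dvdn_biggcdP => l _.
case: (eqVneq l i) => [->|li].
  by apply: dvdn_trans (dvdn_gcdr _ _) _; apply: gcd_over_dvd; rewrite in_setC1.
by apply: dvdn_trans (dvdn_gcdl _ _) _; apply: gcd_over_dvd; rewrite in_setC1.
Qed.

Lemma exists_ne (i : 'I_k) : exists j, j != i.
Proof.
by case: (eqVneq i1 i) => [<-|?]; [exists i2; rewrite eq_sym i1_neq_i2 | exists i1].
Qed.

Lemma gcd_others_gt0 i : 0 < g i.
Proof.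
have [j ji] := exists_ne i; apply: (dvdn_gt0 (a_gt0 j)).
by apply: gcd_over_dvd; rewrite in_setC1.
Qed.

Lemma lt_A i : a i < A.
Proof.
have [j ji] := exists_ne i.
by rewrite /A (sum_others _ i) (bigD1 j) ?in_setC1 //=; have := a_gt0 j; lia.
Qed.

(** Away from the two endpoints, the i-th part of the length set is a full
    residue class. *)
Lemma length_of_class : exists C N, forall x l i, N <= x ->
  x + C <= l * A -> l * a i + C <= x -> l * a i = x %[mod g i] -> L x l.
Proof.
have [N HN] := infty_length_setE a a_gt0.
have [C HC] := generated_frobenius_uniform a.
exists C, N => x l i Nx xA lx /eqP e; apply/HN => //; exists i; split.
- lia.
- by rewrite -/A; lia.
- apply: HC; first by lia.
  by rewrite -eqn_mod_dvd; [rewrite eq_sym | lia].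
- apply: HC; first by rewrite -/A; lia.
  by rewrite -eqn_mod_dvd ?gcd_over_mod // -/A; lia.
Qed.

Lemma length_bottom K : exists N, forall x l, N <= x -> l * A <= x + K ->
  (L x l <-> x <= l * A /\ exists i, generated a [set~ i] (l * A - x)).
Proof.
have [N HN] := infty_length_setE a a_gt0.
have [C HC] := generated_frobenius_uniform a.
exists (N + (K + C) * A) => x l Nx lA; split.
  by move/HN => [|i [_ xA _ ?]]; [lia|split=> //; exists i].
move=> [xA [i Si]]; apply/HN; first by lia.
have iA := lt_A i.
have lKC : K + C <= l by rewrite -(leq_pmul2r (leq_ltn_trans (leq0n _) iA)); lia.
have liA : l * (a i).+1 <= l * A by rewrite leq_mul2l iA orbT.
have lx : l * a i + C <= x by lia.
exists i; split=> //; first by lia.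
apply: HC; first by lia.
rewrite -eqn_mod_dvd; last by lia.
by rewrite eq_sym -gcd_over_mod eqn_mod_dvd //; exact: gcd_over_dvd_generated.
Qed.

(** The hypothesis on l puts it above x / a_j for every j other than i1 and i2,
    and above x / A with a margin, as a_j and A are at least a_i2 + 1. *)
Lemma length_upper : exists C N, forall x l, N <= x -> x + C <= l * (a i2).+1 ->
  (L x l <-> (l * a i1 <= x /\ generated a [set~ i1] (x - l * a i1)) \/
             (l * a i2 <= x /\ generated a [set~ i2] (x - l * a i2))).
Proof.
have [N HN] := infty_length_setE a a_gt0.
have [C HC] := generated_frobenius_uniform a.
exists C.+1, N => x l Nx up.
have up' : l * (a i2).+1 <= l * A by rewrite leq_mul2l lt_A orbT.
split.
  move/HN => /(_ Nx) [i [lx _ Si _]].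
  case: (eqVneq i i1) => [ii|n1]; first by left; rewrite -ii.
  case: (eqVneq i i2) => [ii|n2]; first by right; rewrite -ii.
  have : l * (a i2).+1 <= l * a i by rewrite leq_mul2l a2_min ?orbT.
  lia.
have main i : l * a i <= x -> generated a [set~ i] (x - l * a i) -> L x l.
  move=> lx Si; apply/HN => //; exists i; split=> //; first by rewrite -/A; lia.
  apply: HC; first by rewrite -/A; lia.
  rewrite -eqn_mod_dvd ?gcd_over_mod; last by rewrite -/A; lia.
  by rewrite eq_sym eqn_mod_dvd //; exact: gcd_over_dvd_generated.
by case=> -[]; exact: main.
Qed.


Lemma class_generated C i x l : 
  (forall n, C <= n -> g i %| n -> generated a [set~ i] n) -> l * a i + C <= x ->
  (l * a i <= x /\ generated a [set~ i] (x - l * a i)) <-> l * a i = x %[mod g i].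
Proof.
move=> HC lx; have lx' : l * a i <= x by lia.
split=> [[_ Si]|/eqP e]; [apply/eqP|split=> //; apply: HC; first by lia];
  move: (eqn_mod_dvd (g i) lx'); rewrite eq_sym => E.
  by rewrite E; exact: gcd_over_dvd_generated.
by rewrite -E.
Qed.

Lemma length_two : exists C N, forall x l, N <= x ->
  x + C <= l * (a i2).+1 -> l * a i2 + C <= x ->
  (L x l <-> l * a i1 = x %[mod g i1] \/ l * a i2 = x %[mod g i2]).
Proof.
have [C1 [N H]] := length_upper; have [C2 HC] := generated_frobenius_uniform a.
exists (C1 + C2), N => x l Nx up lx.
have l12 : l * a i1 <= l * a i2 by rewrite leq_mul2l ltnW ?orbT.
rewrite H //; last by lia.
by rewrite (class_generated C2) ?(class_generated C2) //; try exact: HC; lia.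
Qed.

Lemma length_near2 K : exists N, forall x l, N <= x ->
  x <= l * a i2 + K -> l * a i2 <= x + K ->
  (L x l <-> l * a i1 = x %[mod g i1] \/
             (l * a i2 <= x /\ generated a [set~ i2] (x - l * a i2))).
Proof.
have [C1 [N H]] := length_upper; have [C2 HC] := generated_frobenius_uniform a.
exists (N + (K + C1 + C2) * a i2 + K) => x l Nx lo hi.
have lK : K + C1 + C2 <= l by rewrite -(leq_pmul2r (a_gt0 i2)); lia.
have l12 : l * (a i1).+1 <= l * a i2 by rewrite leq_mul2l a12 orbT.
rewrite H; [|lia|lia].
by rewrite (class_generated C2) //; [exact: HC | lia].
Qed.

Lemma length_between : exists C N, forall x l, N <= x ->
  x < l * a i2 -> l * a i1 + C <= x ->
  (L x l <-> l * a i1 = x %[mod g i1]).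
Proof.
have [C1 [N H]] := length_upper; have [C2 HC] := generated_frobenius_uniform a.
exists C2, (N + C1 * a i2) => x l Nx lo hi.
have lC : C1 <= l by rewrite -(leq_pmul2r (a_gt0 i2)); lia.
rewrite H; [|lia|lia].
rewrite (class_generated C2) //; last exact: HC.
by split; [case=> //; lia | left].
Qed.

Lemma length_top K : exists N, forall x l, N <= x -> x <= l * a i1 + K ->
  (L x l <-> l * a i1 <= x /\ generated a [set~ i1] (x - l * a i1)).
Proof.
have [C1 [N H]] := length_upper.
exists (N + (K + C1).+1 * a i1 + K) => x l Nx lo.
have lK : (K + C1).+1 <= l by rewrite -(leq_pmul2r (a_gt0 i1)); lia.
have l12 : l * (a i1).+1 <= l * a i2 by rewrite leq_mul2l a12 orbT.
rewrite H; [|lia|lia].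
by split; [case=> //; lia | left].
Qed.

(** * Gaps that occur in every large element *)

(** Take t in the class of i1 with t + d in the class of i2.  As d is at most
    both moduli, no other element of either class lies strictly in between. *)
Lemma small_gaps : exists N, forall y d, N <= y ->
  0 < d <= minn (g i1) (g i2) -> gap (L y) d.
Proof.
have [C [N H]] := length_two.
have cop := coprime_gcds _ _ i1_neq_i2.
have [N' W] := linear_window _ _ C (g i1 * g i2 + g i1) (ltnSn (a i2)).
exists (N + N') => y d Ny /andP[d0]; rewrite leq_min => /andP[d1 d2].
have [Ny1 Ny2] : N <= y /\ N' <= y by lia.
have [T [lo hi]] := W y Ny2.
have [r1 [_ _ r1E]] := class_window _ _ y 0 (gcd_others_gt0 i1) (coprime_gcd_others i1).
(* r2 is taken at least g i2, hence at least d, so that r2 - d is not truncated. *)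
have [r2 [r2d _ r2E]] :=
  class_window _ _ y (g i2) (gcd_others_gt0 i2) (coprime_gcd_others i2).
have m0 : 0 < g i1 * g i2 by rewrite muln_gt0 !gcd_others_gt0.
have [t [Tt tT tE]] := residue_window _ (chinese (g i1) (g i2) r1 (r2 - d)) T m0.
have t1 : t = r1 %[mod g i1].
  rewrite -(chinese_modl cop r1 (r2 - d)).
  have dv : g i1 %| g i1 * g i2 := dvdn_mulr _ (dvdnn _).
  by rewrite -(modn_dvdm t dv) tE (modn_dvdm _ dv).
have t2 : t + d = r2 %[mod g i2].
  rewrite -[in RHS](subnK (leq_trans d2 r2d)).
  rewrite -(modnDml t) -(modnDml (r2 - d)); congr ((_ + _) %% _).
  rewrite -(chinese_modr cop r1 (r2 - d)).
  have dv : g i2 %| g i1 * g i2 := dvdn_mull _ (dvdnn _).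
  by rewrite -(modn_dvdm t dv) tE (modn_dvdm _ dv).
have c1 : t * a i1 = y %[mod g i1] by rewrite -modnMml t1 modnMml.
have c2 : (t + d) * a i2 = y %[mod g i2] by rewrite -modnMml t2 modnMml.
have Ly e : e <= d -> L y (t + e) <->
    (t + e) * a i1 = y %[mod g i1] \/ (t + e) * a i2 = y %[mod g i2].
  move=> ed; apply: H => //.
    by apply: leq_trans lo _; rewrite leq_mul2r (leq_trans Tt) ?leq_addr ?orbT.
  apply: leq_trans hi; rewrite leq_add2r leq_mul2r addnA.
  by rewrite leq_add ?orbT //; [exact: ltnW | exact: leq_trans ed d1].
exists t; split=> //.
- by rewrite -(addn0 t); apply/Ly => //; left; rewrite addn0.
- by apply/Ly => //; right.
- move=> e /andP[e0 ed] /Ly [||]; first exact: ltnW.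
  + move/(class_eq _ _ _ _ _ (coprime_gcd_others i1))/(_ c1)/eqP.
    rewrite eqn_mod_dvd ?leq_addr // addKn => /(dvdn_leq e0).
    by rewrite leqNgt (leq_trans ed d1).
  + move/(class_eq _ _ _ _ _ (coprime_gcd_others i2) c2)/eqP.
    rewrite eqn_mod_dvd ?leq_add2l; last exact: ltnW.
    rewrite subnDl => /dvdn_leq; rewrite subn_gt0 => /(_ ed).
    by rewrite leqNgt (leq_trans _ d2) // ltn_subrL e0 d0.
Qed.

Lemma gap_g1 : exists N, forall y, N <= y -> gap (L y) (g i1).
Proof.
have [C [N H]] := length_between.
have [N' W] := linear_window _ _ C.+1 (g i1).*2 a12.
exists (N + N') => y Ny.
have [|T [lo hi]] := W y; first by lia.
have [t [Tt tT tE]] := class_window _ _ y T (gcd_others_gt0 i1) (coprime_gcd_others i1).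
have Ly e : e <= g i1 -> L y (t + e) <-> (t + e) * a i1 = y %[mod g i1].
  move=> ed; apply: H; first by lia.
    suff : T * a i2 <= (t + e) * a i2 by lia.
    by rewrite leq_mul2r; apply/orP; right; lia.
  suff : (t + e) * a i1 <= (T + (g i1).*2) * a i1 by lia.
  rewrite leq_mul2r; apply/orP; right; lia.
exists t; split; first by rewrite -(addn0 t); apply/Ly => //; rewrite addn0.
- by apply/Ly => //; rewrite mulnDl addnC mulnC modnMDl.
- exact: gcd_others_gt0.
- move=> e /andP[e0 ed] /Ly; move/(_ (ltnW ed)).
  move/(class_eq _ _ _ _ _ (coprime_gcd_others i1))/(_ tE)/eqP.
  by rewrite eqn_mod_dvd ?leq_addr // addKn => /(dvdn_leq e0); lia.
Qed.

(** * Gaps in each regime *)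

Lemma length_bounds : exists N, forall x l, N <= x -> L x l ->
  x <= l * A /\ l * a i1 <= x.
Proof.
have [N HN] := infty_length_setE a a_gt0.
exists N => x l Nx /(HN _ _ Nx) [i [lx xA _ _]]; split=> //.
by apply: leq_trans lx; rewrite leq_mul2l a1_min orbT.
Qed.

(** A class with modulus g_i meets every window of length g_i; all the upper
    bounds on gaps come from this. *)
Lemma length_meets_window : exists C N, forall x T i, N <= x ->
  x + C <= T * A -> (T + g i) * a i + C <= x ->
  exists l, [/\ T < l, l <= T + g i & L x l].
Proof.
have [C [N mid]] := length_of_class.
exists C, N => x T i Nx lo hi.
have [t [Tt tT tE]] :=
  class_window _ _ x T.+1 (gcd_others_gt0 i) (coprime_gcd_others i).
rewrite addSn ltnS in tT; exists t; split=> //; apply: (mid _ _ i) => //.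
  by apply: leq_trans lo _; rewrite leq_mul2r ltnW ?orbT.
by apply: leq_trans hi; rewrite leq_add2r leq_mul2r tT orbT.
Qed.

(** A longer gap would leave room, at a safe distance from the two ends of the
    length set, for an element of the class of i1. *)
Lemma gap_bounded : exists D N, forall x u d, N <= x -> gap_at (L x) u d -> d <= D.
Proof.
have [C [N meet]] := length_meets_window.
have [N' bnd] := length_bounds.
exists (C + g i1 + C), (N + N') => x u d Nx [Lu Lv d0 no].
have [Nx1 Nx2] : N <= x /\ N' <= x by lia.
have [uA _] := bnd x u Nx2 Lu; have [_ v1] := bnd x (u + d) Nx2 Lv.
have A0 : 0 < A := leq_ltn_trans (leq0n _) (lt_A i1).
have CA : C <= C * A by rewrite leq_pmulr.
have Ca : C <= C * a i1 by rewrite leq_pmulr.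
rewrite leqNgt; apply/negP => dbig.
have mon : (u + C + g i1 + C) * a i1 <= (u + d) * a i1.
  by rewrite leq_mul2r -!addnA leq_add2l !addnA (ltnW dbig) orbT.
have [|| t [tlo thi Lt]] := meet x (u + C) i1 Nx1; [by lia | by lia |].
apply: (no (t - u)); first by lia.
by rewrite subnKC //; lia.
Qed.

Lemma gap_middle : exists C N, forall x u d, N <= x -> gap_at (L x) u d ->
  x + C <= u * A -> (u + d) * a i2 + C <= x -> 0 < d <= minn (g i1) (g i2).
Proof.
have [C [N meet]] := length_meets_window.
exists C, N => x u d Nx [_ _ d0 no] lo hi.
suff dg i : a i <= a i2 -> d <= g i by rewrite d0 leq_min !dg // ltnW.
move=> ai; rewrite leqNgt; apply/negP => gd.
have mon : (u + g i) * a i <= (u + d) * a i2.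
  by apply: leq_mul => //; rewrite leq_add2l ltnW.
have [|t [tlo thi Lt]] := meet x u i Nx lo; first by lia.
apply: (no (t - u)); first by lia.
by rewrite subnKC //; lia.
Qed.

Lemma gap_between : exists C N, forall x u d, N <= x -> gap_at (L x) u d ->
  x < u * a i2 -> (u + d) * a i1 + C <= x -> d = g i1.
Proof.
have [C [N btw]] := length_between.
exists C, N => x u d Nx [Lu Lv d0 no] lo hi.
have class e : e <= d -> L x (u + e) <-> (u + e) * a i1 = x %[mod g i1].
  move=> ed; apply: btw => //.
    by apply: leq_trans lo _; rewrite leq_mul2r leq_addr orbT.
  by apply: leq_trans hi; rewrite leq_add2r leq_mul2r leq_add2l ed orbT.
have uc : u * a i1 = x %[mod g i1].
  by rewrite -[u]addn0; apply/class => //; rewrite addn0.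
have vc : (u + d) * a i1 = x %[mod g i1] by apply/class.
have /eqP := class_eq _ _ _ _ _ (coprime_gcd_others i1) vc uc.
rewrite eqn_mod_dvd ?leq_addr // addKn => /(dvdn_leq d0).
rewrite leq_eqVlt => /orP[/eqP //|lt].
case: (no (g i1)); first by rewrite gcd_others_gt0.
by apply/class; rewrite 1?ltnW // mulnDl addnC mulnC modnMDl.
Qed.

(** * Transporting gaps between congruent elements *)

Lemma gap_transfer_bottom K : exists N, forall x y u d, N <= x -> N <= y ->
  x = y %[mod A] -> (u + d) * A <= x + K -> gap_at (L x) u d -> gap (L y) d.
Proof.
have [N bottom] := length_bottom K.
exists N => x y u d Nx Ny xy hi ud; have [Lu _ _ _] := ud.
have A0 : 0 < A := leq_ltn_trans (leq0n _) (lt_A i1).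
have mon e : e <= d -> e * A <= d * A by move=> ed; rewrite leq_mul2r ed orbT.
have uhi : u * A <= x + K by clear xy; lia.
have [xu _] := proj1 (bottom x u Nx uhi) Lu.
have [|u' u'E] := shift_exists A x y u A0 xy; first by lia.
clear xy; apply: (gap_shift (L x) _ u u') ud => e ed; have eA := mon e ed.
have sh : (u' + e) * A + x = (u + e) * A + y by lia.
rewrite bottom //; last by lia.
rewrite bottom //; last by lia.
have -> : (x <= (u + e) * A) = (y <= (u' + e) * A) by lia.
by have -> : (u + e) * A - x = (u' + e) * A - y by lia.
Qed.

(** The translation by (y - x) / a_i2 is a multiple of g_i1, and thus also
    preserves the class of i1. *)
Lemma gap_transfer_near2 K : exists N, forall x y u d, N <= x -> N <= y ->
  x = y %[mod g i1 * a i2] -> x <= u * a i2 + K -> (u + d) * a i2 <= x + K ->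
  gap_at (L x) u d -> gap (L y) d.
Proof.
have [N near2] := length_near2 K.
exists (N + K) => x y u d NKx NKy xy lo hi ud.
have [Nx Ny] : N <= x /\ N <= y by clear xy; lia.
have mon e : e <= d -> e * a i2 <= d * a i2 by move=> ed; rewrite leq_mul2r ed orbT.
have xy1 : x = y %[mod g i1].
  by rewrite -(modn_dvdm x (dvdn_mulr (a i2) (dvdnn (g i1)))) xy modn_dvdm ?dvdn_mulr.
have xy2 : x = y %[mod a i2].
  by rewrite -(modn_dvdm x (dvdn_mull (g i1) (dvdnn (a i2)))) xy modn_dvdm ?dvdn_mull.
have le : x <= u * a i2 + y by clear xy xy1 xy2; lia.
have [u' u'E] := shift_exists (a i2) x y u (a_gt0 _) xy2 le.
have uu' : u = u' %[mod g i1].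
  have /eqP : u' * a i2 + x = u * a i2 + x %[mod g i1 * a i2].
    by rewrite u'E -modnDmr -xy modnDmr.
  by rewrite eqn_modDr -!muln_modl eqn_pmul2r ?a_gt0 // => /eqP ->.
have class e : ((u + e) * a i1 = x %[mod g i1]) = ((u' + e) * a i1 = y %[mod g i1]).
  by rewrite -modnMml -modnDml uu' modnDml modnMml xy1.
clear xy xy1 xy2 uu'.
apply: (gap_shift (L x) _ u u') ud => e ed; have eA := mon e ed.
have sh : (u' + e) * a i2 + x = (u + e) * a i2 + y by lia.
rewrite near2 //; [|by lia|by lia].
rewrite near2 //; [|by lia|by lia].
have -> : ((u + e) * a i2 <= x) = ((u' + e) * a i2 <= y) by lia.
have -> : x - (u + e) * a i2 = y - (u' + e) * a i2 by lia.
by rewrite class.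
Qed.

Lemma gap_transfer_top K : exists N, forall x y u d, N <= x -> N <= y ->
  x = y %[mod a i1] -> x <= u * a i1 + K -> gap_at (L x) u d -> gap (L y) d.
Proof.
have [N top] := length_top K.
exists (N + K) => x y u d NKx NKy xy lo ud.
have le : x <= u * a i1 + y by clear xy; lia.
have [u' u'E] := shift_exists (a i1) x y u (a_gt0 _) xy le.
clear xy; apply: (gap_shift (L x) _ u u') ud => e ed.
have sh : (u' + e) * a i1 + x = (u + e) * a i1 + y by lia.
rewrite top; [|by lia|by lia].
rewrite top; [|by lia|by lia].
have -> : ((u + e) * a i1 <= x) = ((u' + e) * a i1 <= y) by lia.
by have -> : x - (u + e) * a i1 = y - (u' + e) * a i1 by lia.
Qed.

(** Symmetric in x and y, so that one statement gives both inclusions. *)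
Lemma gap_transfer (p : nat) : A %| p -> a i1 %| p -> g i1 * a i2 %| p ->
  exists N, forall x y d, N <= x -> N <= y -> x = y %[mod p] ->
    gap (L x) d -> gap (L y) d.
Proof.
move=> Ap a1p g1a2p.
have [D [N1 bounded]] := gap_bounded.
have [C2 [N2 middle]] := gap_middle.
have [C3 [N3 between]] := gap_between.
(* A gap has length at most D, so D * A bounds the variation of l * a_i and of
   l * A along it: with windows of this width around the endpoints, every gap
   lies within a window or on one side of it. *)
have [K KE] : exists K, K = C2 + C3 + D * A by eexists.
have [N4 bottom] := gap_transfer_bottom K.
have [N5 near2] := gap_transfer_near2 K.
have [N6 top] := gap_transfer_top K.
have [N7 small] := small_gaps.
have [N8 gapg1] := gap_g1.
exists (N1 + N2 + N3 + N4 + N5 + N6 + N7 + N8) => x y d Nx Ny xy [u ud].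
have xy_dvd b : b %| p -> x = y %[mod b].
  by move=> bp; rewrite -(modn_dvdm x bp) xy (modn_dvdm _ bp).
have {}bottom := bottom x y u d _ _ (xy_dvd _ Ap) _ ud.
have {}near2 := near2 x y u d _ _ (xy_dvd _ g1a2p) _ _ ud.
have {}top := top x y u d _ _ (xy_dvd _ a1p) _ ud.
clear xy xy_dvd Ap a1p g1a2p.
have dD : d <= D by apply: (bounded x u d) => //; lia.
have dA : d * A <= D * A by rewrite leq_mul2r dD orbT.
have d2 : d * a i2 <= d * A by rewrite leq_mul2l (ltnW (lt_A _)) orbT.
have d1 : d * a i1 <= d * A by rewrite leq_mul2l (ltnW (lt_A _)) orbT.
case: (leqP ((u + d) * A) (x + K)) => [?|ncaseA]; first by apply: bottom => //; lia.
case: (leqP ((u + d) * a i2 + C2) x) => [?|ncaseB].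
  by apply: small; [lia | apply: (middle x u d) => //; lia].
case: (leqP ((u + d) * a i2) (x + K)) => [?|ncaseC]; first by apply: near2 => //; lia.
case: (leqP ((u + d) * a i1 + C3) x) => [?|ncaseD]; last by apply: top => //; lia.
by rewrite (between x u d) //; [apply: gapg1; lia | lia | lia].
Qed.

End Regimes.

(** * Consequences of the hypotheses on the semigroup *)

(** A zero generator could be removed, against minimality. *)
Lemma minimal_generators_gt0 {k : nat} (a : 'I_k -> nat) (S : set nat) :
  minimal_generators a S -> forall j, 0 < a j.
Proof.
move=> [Sgen Smin] i; rewrite lt0n; apply/eqP => ai0.
apply: (Smin [set~ i]%SET).
  by apply/properP; split; [exact: finset.subsetT | exists i; rewrite !inE ?eqxx].
rewrite -Sgen; apply/predeqP => x; split=> -[z ->].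
  exists [ffun j => if j == i then 0 else z j].
  rewrite [RHS](big_setD1 i) ?inE // finset.setTD /= ai0 muln0 add0n.
  by apply: eq_bigr => j; rewrite in_setC1 ffunE => /negPf ->.
by exists z; rewrite (big_setD1 i) ?inE // finset.setTD /= ai0 muln0 add0n.
Qed.

(** The semigroup contains two consecutive integers, both divisible by the gcd. *)
Lemma numerical_semigroup_gcd {k : nat} (a : 'I_k -> nat) (S : set nat) :
  numerical_semigroup S -> generated a [set: 'I_k]%SET = S ->
  gcd_over a [set: 'I_k] = 1.
Proof.
move=> [_ _ /finite_seqP [s sE]] Sgen.
have big n : \max_(i <- s) i < n -> gcd_over a [set: 'I_k] %| n.
  move=> sn; apply: gcd_over_dvd_generated; rewrite Sgen.
  apply: contrapT => nS; have : [set` s]%classic n by rewrite -sE.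
  by move=> /= ns; have := leq_bigmax_seq (F := fun i : nat => i) n ns isT; rewrite leqNgt sn.
set M := \max_(i <- s) i in big.
have := dvdn_sub (big M.+2 (leqW (ltnSn _))) (big M.+1 (ltnSn _)).
by rewrite subSn // subnn dvdn1 => /eqP.
Qed.

Theorem theorem2p6 (k : nat) (hk : 1 < k) (S : set nat) (a : 'I_k -> nat)
    (hS : numerical_semigroup S)
    (ha_min : minimal_generators a S)
    (ha_incr : forall i j : 'I_k, i < j -> a i < a j) :
  let a1 := a (Ordinal (ltnW hk)) in
  let a2 := a (Ordinal hk) in
  let A := \sum_(i < k) a i in
  let g1 := \big[gcdn/0]_(i < k | 0 < i) a i in
  let p := lcmn (lcmn a1 (g1 * a2)) A in
  exists N : nat, forall x : nat, S x -> N <= x ->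
    infty_delta_set a (x + p) = infty_delta_set a x.
Proof.
set i1 := Ordinal (ltnW hk); set i2 := Ordinal hk; move=> a1 a2 A g1 p.
have a0 := minimal_generators_gt0 a S ha_min.
have gcd1 := numerical_semigroup_gcd a S hS (proj1 ha_min).
have a12 : a i1 < a i2 by apply: ha_incr.
have a2_min j : j != i1 -> j != i2 -> a i2 < a j.
  by rewrite -!val_eqE /= => j1 j2; apply: ha_incr => /=; lia.
have g1E : g1 = gcd_over a [set~ i1].
  by apply: eq_bigl => j; rewrite in_setC1 -val_eqE lt0n.
have Ap : A %| p by exact: dvdn_lcmr.
have a1p : a i1 %| p.
  by apply: dvdn_trans (dvdn_lcml _ _); exact: dvdn_lcml.
have g1a2p : gcd_over a [set~ i1] * a i2 %| p.
  by rewrite -g1E; apply: dvdn_trans (dvdn_lcml _ _); exact: dvdn_lcmr.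
have [N H] := gap_transfer k a i1 i2 a0 gcd1 a12 a2_min p Ap a1p g1a2p.
have [N' bnd] := length_bounds k a i1 i2 a0 a12 a2_min.
have deltaE x : N' <= x -> infty_delta_set a x = gap (infty_length_set a x).
  move=> N'x; apply: (infty_delta_setE _ _ x) => l /(bnd _ _ N'x) [_ lx].
  by apply: leq_trans lx; rewrite leq_pmulr.
exists (N + N') => x _ Nx; rewrite !deltaE; try lia.
by apply/predeqP => d; split; apply: H; rewrite ?modnDr //; lia.
Qed.
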